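(* Let $(A,\phi_0,P,N)$ be a Jacobi-Nijenhuis algebroid over $M$ with anchor $\rho$. Then it defines a hierarchy of pairwise compatible Jacobi structures on $M$: for every $k\ge 0$ the pair $\big(\rho^2(N^kP),\ \rho(N^kP^\sharp(\phi_0))\big)$ is a Jacobi structure on $M$, and any two of these Jacobi structures are compatible.
   Context: A Jacobi algebroid $(A,\phi_0)$ is a Lie algebroid $(A,[\cdot,\cdot],\rho)$ over $M$ with a 1-cocycle $\phi_0\in\Gamma(A^* )$ ($\mathrm d\phi_0=0$). The Schouten bracket on $\Gamma(\wedge^\bullet A)$ extends the Lie bracket with $[X,f]=\rho(X)f$, $[P,Q]=-(-1)^{(p-1)(q-1)}[Q,P]$, $[P,Q\wedge R]=[P,Q]\wedge R+(-1)^{(p-1)q}Q\wedge[P,R]$. The Schouten-Jacobi bracket is $[P,Q]^{\phi_0}=[P,Q]+(p-1)P\wedge i_{\phi_0}Q-(-1)^{p-1}(q-1)\,i_{\phi_0}P\wedge Q$. For a bivector $P$, $P^\sharp:A^*\to A$ is given by $\langle\beta,P^\sharp\alpha\rangle=P(\alpha,\beta)$. A Jacobi bivector is $P\in\Gamma(\wedge^2A)$ with $[P,P]^{\phi_0}=0$. The $\phi_0$-differential is $\mathrm d^{\phi_0}\omega=\mathrm d\omega+\phi_0\wedge\omega$ and $\mathcal L^{\phi_0}_X=i_X\mathrm d^{\phi_0}+\mathrm d^{\phi_0}i_X$ for sections $X$ of $A$. A bivector $Q$ on a Jacobi algebroid $(A,\phi_0)$ defines the bracket on $\Gamma(A^*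 )$: $[\alpha,\beta]_Q=\mathcal L^{\phi_0}_{Q^\sharp\alpha}\beta-\mathcal L^{\phi_0}_{Q^\sharp\beta}\alpha-\mathrm d^{\phi_0}(Q(\alpha,\beta))$. A Nijenhuis operator is a bundle map $N:A\to A$ over the identity with $[NX,NY]=N[X,Y]_N$, where $[X,Y]_N=[NX,Y]+[X,NY]-N[X,Y]$; then $A_N=(A,[\cdot,\cdot]_N,\rho\circ N)$ is a Lie algebroid and $\phi_1=N^*\phi_0$ is a 1-cocycle of it. A Jacobi-Nijenhuis algebroid $(A,\phi_0,P,N)$ is a Jacobi algebroid with a Jacobi bivector $P$ and a Nijenhuis operator $N$ that are compatible: (1) $N\circ P^\sharp=P^\sharp\circ N^*$ (so $NP$, with $(NP)^\sharp=N\circ P^\sharp$, is a bivector); (2) the bracket $[\cdot,\cdot]_{NP}$ on $\Gamma(A^* )$ defined by $NP$ on $(A,\phi_0)$ equals the bracket $[\cdot,\cdot]_P^N$ defined by the bivector $P$ on $(A_N,\phi_1)$. The bivector $N^kP$ is defined by $(N^kP)^\sharp=N^k\circ P^\sharp$. For a bivector $P$ on $A$, $\rho^2P\in\Gamma(\wedge^2TM)$ is $\rho^2P(\alpha,\beta)=P(\rho^*\alpha,\rho^*\beta)$. A Jacobi structure on $M$ is a pair $(\Lambda,E)$ of a bivector field and a vector field with $[\Lambda,\Lambda]=-2E\wedge\Lambda$, $[E,\Lambda]=0$. Two Jacobi structures $(\Lambda_1,E_1)$, $(\Lambda_2,E_2)$ are compatible if $(\Lambda_1+\Lambda_2,E_1+E_2)$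 is a Jacobi structure; equivalently $[\Lambda_1,\Lambda_2]=-E_1\wedge\Lambda_2-E_2\wedge\Lambda_1$ and $[E_1,\Lambda_2]+[E_2,\Lambda_1]=0$. *)

(* Defs.v *)
From HB Require Import structures.
From mathcomp Require Import all_boot all_order all_algebra.
From mathcomp Require Import all_classical all_reals all_analysis.
From mathcomp Require Import ring.
Set Implicit Arguments.
Unset Strict Implicit.
Unset Printing Implicit Defensive.
Import Order.TTheory GRing.Theory Num.Theory.
Import numFieldNormedType.Exports.
Local Open Scope classical_set_scope.
Local Open Scope ring_scope.

(* Smooth manifolds and vector bundles are given by atlases and local         *)
(* trivializations.  The tensor calculus is done on modules of sections over  *)
(* the ring C of smooth functions, with the usual identifications:            *)
(*   vector fields                = derivations of C,                         *)
(*   bundle maps over the identity = C-linear maps between sections,          *)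
(*   sections of the dual bundle  = C-linear maps from sections to C,         *)
(*   multivectors                 = exterior algebra over C of the sections.  *)

Section SmoothEuclidean.
Variables (R : realType) (n : nat).

(* On an open set U: all iterated directional derivatives of f of order at    *)
(* most k exist and are continuous.                                           *)
Fixpoint Ck (k : nat) (U : set 'rV[R]_n) (f : 'rV[R]_n -> R) : Prop :=
  (forall x, U x -> {for x, continuous f}) /\
  if k is k'.+1 then
    forall v, exists2 g, forall x, U x -> is_derive x v f (g x) & Ck k' U g
  else True.

Definition smooth_on (U : set 'rV[R]_n) (f : 'rV[R]_n -> R) :=
  forall k, Ck k U f.

Lemma Ck_cst k U (a : R) : Ck k U (fun=> a).
Proof.
elim: k a => [|k IH] a; split => //; try by move=> x _; exact: cst_continuous.
by move=> v; exists (fun=> 0); [move=> x _; exact: is_derive_cst | exact: IH].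
Qed.

Lemma CkD k U f g : Ck k U f -> Ck k U g -> Ck k U (f \+ g).
Proof.
elim: k f g => [|k IH] f g [cf df] [cg dg]; split => //;
  try by move=> x Ux; apply: continuousD; [exact: cf|exact: cg].
move=> v; have [f' f'P Cf'] := df v; have [g' g'P Cg'] := dg v.
exists (f' \+ g'); last exact: IH.
by move=> x Ux; apply: is_deriveD; [exact: f'P|exact: g'P].
Qed.

Lemma Ck_S k U f : Ck k.+1 U f -> Ck k U f.
Proof.
elim: k f => [|k IH] f [cf df]; split => //.
by move=> v; have [g gP Cg] := df v; exists g => //; exact: IH.
Qed.

Lemma CkM k U f g : Ck k U f -> Ck k U g -> Ck k U (f \* g).
Proof.
elim: k f g => [|k IH] f g Cf Cg.
  by split => // x Ux; apply: continuousM; [exact: Cf.1|exact: Cg.1].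
have Cf0 := Ck_S Cf; have Cg0 := Ck_S Cg.
case: Cf Cg => [cf df] [cg dg]; split.
  by move=> x Ux; apply: continuousM; [exact: cf|exact: cg].
move=> v; have [f' f'P Cf'] := df v; have [g' g'P Cg'] := dg v.
exists ((f \* g') \+ (g \* f')); last by apply: CkD; exact: IH.
by move=> x Ux; apply: is_deriveM; [exact: f'P|exact: g'P].
Qed.

End SmoothEuclidean.

(* A homeomorphism cmap from the open set cdom onto an open subset of R^n,    *)
(* with inverse cinv; values outside these sets are irrelevant.               *)
Record chart (R : realType) (M : topologicalType) (n : nat) := Chart {
  cdom : set M;
  cmap : M -> 'rV[R]_n;
  cinv : 'rV[R]_n -> M;
  cdom_open : open cdom;
  cimg_open : open (cmap @` cdom);
  cmapK : forall x, cdom x -> cinv (cmap x) = x;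
  cmap_continuous : forall x, cdom x -> {for x, continuous cmap};
  cinv_continuous : forall y, (cmap @` cdom) y -> {for y, continuous cinv} }.

Record manifold (R : realType) := Manifold {
  space :> topologicalType;
  mdim : nat;
  atlas : set (chart R space mdim);
  manifold_hausdorff : hausdorff_space space;
  manifold_second_countable : @second_countable space;
  atlas_cover : forall x, exists2 c, atlas c & cdom c x;
  atlas_compat : forall c c', atlas c -> atlas c' -> forall j,
    smooth_on (cmap c @` (cdom c `&` cdom c'))
              (fun y => cmap c' (cinv c y) ord0 j) }.

Section SmoothFunctions.
Variables (R : realType) (M : manifold R).

Definition smooth_in (U : set M) (f : M -> R) :=
  forall c, atlas c -> smooth_on (cmap c @` (cdom c `&` U)) (f \o cinv c).

Lemma smooth_in_cst U (a : R) : smooth_in U (fun=> a).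
Proof. by move=> c _ k; exact: Ck_cst. Qed.

Lemma smooth_inD U f g :
  smooth_in U f -> smooth_in U g -> smooth_in U (f \+ g).
Proof. by move=> sf sg c ac k; apply: CkD; [exact: sf|exact: sg]. Qed.

Lemma smooth_inM U f g :
  smooth_in U f -> smooth_in U g -> smooth_in U (f \* g).
Proof. by move=> sf sg c ac k; apply: CkM; [exact: sf|exact: sg]. Qed.

Lemma smooth_in_sub U V f : (V `<=` U) -> smooth_in U f -> smooth_in V f.
Proof.
move=> VU sf c ac k.
have {sf} := sf c ac k; move: (f \o cinv c) => {}f.
have UV : cmap c @` (cdom c `&` V) `<=` cmap c @` (cdom c `&` U).
  by move=> _ [x [cx Vx] <-]; exists x => //; split => //; exact: VU.
elim: k f => [|k IH] f [cf df]; split => //; try by move=> x /UV; exact: cf.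
move=> v; have [g gP Cg] := df v; exists g; last exact: IH.
by move=> x /UV; exact: gP.
Qed.

Definition smooth_pred : {pred (M -> R)} := fun f => `[< smooth_in setT f >].

Lemma smooth_subring : subring_closed smooth_pred.
Proof.
have m1 f : smooth_in setT f -> smooth_in setT (\- f).
  move=> sf; have -> : \- f = (fun=> -1) \* f.
    by apply/funext => x /=; rewrite mulN1r.
  by apply: smooth_inM => //; exact: smooth_in_cst.
split=> [|f g|f g].
- by apply/asboolP; exact: smooth_in_cst.
- by move=> /asboolP sf /asboolP sg; apply/asboolP/smooth_inD => //; exact: m1.
- by move=> /asboolP sf /asboolP sg; apply/asboolP/smooth_inM.
Qed.

Lemma smooth_scale : GRing.scaler_closed smooth_pred.
Proof.
move=> a f /asboolP sf; apply/asboolP.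
by apply: (@smooth_inM setT (fun=> a) f) => //; exact: smooth_in_cst.
Qed.

HB.instance Definition _ :=
  GRing.isSubringClosed.Build (M -> R) smooth_pred smooth_subring.
HB.instance Definition _ :=
  GRing.isScaleClosed.Build R (M -> R) smooth_pred smooth_scale.

Record cinf := Cinf { cinf_fun :> M -> R; cinfP : cinf_fun \in smooth_pred }.

HB.instance Definition _ := [isSub for cinf_fun].
HB.instance Definition _ := [Choice of cinf by <:].
HB.instance Definition _ := 
  GRing.SubChoice_isSubComPzRing.Build _ _ cinf (subringClosedP _).
HB.instance Definition _ := [SubZmodule_isSubLmodule of cinf by <:].

Lemma cinf_smooth (f : cinf) : smooth_in setT f.
Proof. by move: (cinfP f) => /asboolP. Qed.

End SmoothFunctions.

Section VectorBundles.
Variables (R : realType) (M : manifold R).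

Record trivialization (F : M -> lmodType R) (r : nat) := Trivialization {
  tdom : set M;
  tmap : forall x, {linear F x -> 'rV[R]_r};
  tinv : forall x, 'rV[R]_r -> F x;
  tdom_open : open tdom;
  tmapK : forall x, tdom x -> cancel (@tmap x) (@tinv x);
  tinvK : forall x, tdom x -> cancel (@tinv x) (@tmap x) }.

Record vbundle := VBundle {
  fib : M -> lmodType R;
  rank : nat;
  trivs : set (trivialization fib rank);
  trivs_cover : forall x, exists2 t, trivs t & tdom t x;
  trivs_compat : forall t t', trivs t -> trivs t' -> forall v j,
    smooth_in (tdom t `&` tdom t')
              (fun x => tmap t' x (tinv t x v) ord0 j) }.

Variable E : vbundle.

Definition smooth_section (s : forall x, fib E x) := forall t, trivs t ->
  forall j, smooth_in (tdom t) (fun x => tmap t x (s x) ord0 j).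

Record section := Section {
  sec_fun :> forall x, fib E x;
  sec_smooth : smooth_section sec_fun }.

Lemma section_ext (s t : section) : (forall x, s x = t x) -> s = t.
Proof.
case: s t => s sP [t tP] /= st.
have {}st : s = t by apply: functional_extensionality_dep.
by subst t; congr Section; exact: Prop_irrelevance.
Qed.

HB.instance Definition _ := gen_eqMixin section.
HB.instance Definition _ := gen_choiceMixin section.

Program Definition sec0 := @Section (fun x => 0) _.
Next Obligation.
move=> t _ j; rewrite (_ : (fun _ => _) = (fun=> 0)); first exact: smooth_in_cst.
by apply/funext => x; rewrite raddf0 mxE.
Qed.

Program Definition secD (s t : section) := @Section (fun x => s x + t x) _.
Next Obligation.
move=> s t u tu j.
rewrite (_ : (fun _ => _) = (fun x => tmap u x (s x) ord0 j) \+
  (fun x => tmap u x (t x) ord0 j)).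
  by apply: smooth_inD; exact: sec_smooth.
by apply/funext => x; rewrite raddfD mxE.
Qed.

Program Definition secZ (f : cinf M) (s : section) :=
  @Section (fun x => f x *: s x) _.
Next Obligation.
move=> f s u tu j.
rewrite (_ : (fun _ => _) = f \* (fun x => tmap u x (s x) ord0 j)).
  apply: smooth_inM; last exact: sec_smooth.
  by apply: smooth_in_sub (@cinf_smooth _ _ f).
by apply/funext => x; rewrite linearZ mxE.
Qed.

Definition secN (s : section) := secZ (-1) s.

Fact secDA : associative secD.
Proof. by move=> s t u; apply: section_ext => x /=; rewrite addrA. Qed.
Fact secDC : commutative secD.
Proof. by move=> s t; apply: section_ext => x /=; rewrite addrC. Qed.
Fact sec0D : left_id sec0 secD.
Proof. by move=> s; apply: section_ext => x /=; rewrite add0r. Qed.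
Fact secND : left_inverse sec0 secN secD.
Proof.
by move=> s; apply: section_ext => x /=; rewrite scaleN1r addNr.
Qed.

HB.instance Definition _ :=
  GRing.isZmodule.Build section secDA secDC sec0D secND.

Fact secZA f g s : secZ f (secZ g s) = secZ (f * g) s.
Proof. by apply: section_ext => x /=; rewrite scalerA. Qed.
Fact sec1Z : left_id 1 secZ.
Proof. by move=> s; apply: section_ext => x /=; rewrite scale1r. Qed.
Fact secZDr : right_distributive secZ +%R.
Proof. by move=> f s t; apply: section_ext => x /=; rewrite scalerDr. Qed.
Fact secZDl s : {morph secZ^~ s : f g / f + g}.
Proof. by move=> f g; apply: section_ext => x /=; rewrite scalerDl. Qed.

HB.instance Definition _ :=
  GRing.Zmodule_isLmodule.Build (cinf M) section secZA sec1Z secZDr secZDl.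

End VectorBundles.

Section VectorFields.
Variables (R : realType) (M : manifold R).
Notation C := (cinf M).

Record vfield := VField {
  vf_fun :> C -> C;
  vf_linear : forall (a : R) (f g : C),
    vf_fun (a *: f + g) = a *: vf_fun f + vf_fun g;
  vf_leibniz : forall f g, vf_fun (f * g) = vf_fun f * g + f * vf_fun g }.

Lemma vfield_ext (X Y : vfield) : (forall f, X f = Y f) -> X = Y.
Proof.
case: X Y => X XP XL [Y YP YL] /= /funext XY; subst Y.
by congr VField; exact: Prop_irrelevance.
Qed.

HB.instance Definition _ := gen_eqMixin vfield.
HB.instance Definition _ := gen_choiceMixin vfield.

Lemma cinf_scaleA (a : R) (f g : C) : a *: (f * g) = (a *: f) * g.
Proof. by apply: val_inj; apply/funext => x; exact: mulrA. Qed.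

Lemma vfD (X : vfield) f g : X (f + g) = X f + X g.
Proof. by have := vf_linear X 1 f g; rewrite !scale1r. Qed.

Lemma vf0 (X : vfield) : X 0 = 0.
Proof. by apply: (@addrI _ (X 0)); rewrite -vfD !addr0. Qed.

Lemma vfZ (X : vfield) (a : R) f : X (a *: f) = a *: X f.
Proof. by have := vf_linear X a f 0; rewrite vf0 !addr0. Qed.

Lemma vfN (X : vfield) f : X (- f) = - X f.
Proof. by rewrite -scaleN1r vfZ scaleN1r. Qed.

Program Definition vfield0 := @VField (fun=> 0) _ _.
Next Obligation. by move=> a f g; rewrite scaler0 addr0. Qed.
Next Obligation. by move=> f g; rewrite mul0r mulr0 addr0. Qed.

Program Definition vfieldD (X Y : vfield) := @VField (fun f => X f + Y f) _ _.
Next Obligation.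
by move=> X Y a f g /=; rewrite !vf_linear scalerDr addrACA.
Qed.
Next Obligation.
by move=> X Y f g /=; rewrite !vf_leibniz mulrDl mulrDr addrACA.
Qed.

Program Definition vfieldZ (h : C) (X : vfield) := @VField (fun f => h * X f) _ _.
Next Obligation.
move=> h X a f g /=; rewrite vf_linear mulrDr; congr (_ + _).
by rewrite mulrC -cinf_scaleA mulrC.
Qed.
Next Obligation.
by move=> h X f g /=; rewrite vf_leibniz mulrDr mulrA; congr (_ + _); rewrite mulrCA.
Qed.

Definition vfieldN (X : vfield) := vfieldZ (-1) X.

Fact vfieldDA : associative vfieldD.
Proof. by move=> X Y Z; apply: vfield_ext => f /=; rewrite addrA. Qed.
Fact vfieldDC : commutative vfieldD.
Proof. by move=> X Y; apply: vfield_ext => f /=; rewrite addrC. Qed.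
Fact vfield0D : left_id vfield0 vfieldD.
Proof. by move=> X; apply: vfield_ext => f /=; rewrite add0r. Qed.
Fact vfieldND : left_inverse vfield0 vfieldN vfieldD.
Proof. by move=> X; apply: vfield_ext => f /=; rewrite mulN1r addNr. Qed.

HB.instance Definition _ :=
  GRing.isZmodule.Build vfield vfieldDA vfieldDC vfield0D vfieldND.

Fact vfieldZA f g X : vfieldZ f (vfieldZ g X) = vfieldZ (f * g) X.
Proof. by apply: vfield_ext => h /=; rewrite mulrA. Qed.
Fact vfield1Z : left_id 1 vfieldZ.
Proof. by move=> X; apply: vfield_ext => f /=; rewrite mul1r. Qed.
Fact vfieldZDr : right_distributive vfieldZ +%R.
Proof. by move=> f X Y; apply: vfield_ext => g /=; rewrite mulrDr. Qed.
Fact vfieldZDl X : {morph vfieldZ^~ X : f g / f + g}.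
Proof. by move=> f g; apply: vfield_ext => h /=; rewrite mulrDl. Qed.

HB.instance Definition _ :=
  GRing.Zmodule_isLmodule.Build C vfield vfieldZA vfield1Z vfieldZDr vfieldZDl.

Program Definition vf_bracket (X Y : vfield) :=
  @VField (fun f => X (Y f) - Y (X f)) _ _.
Next Obligation.
by move=> X Y a f g /=; rewrite !vf_linear scalerBr opprD addrACA.
Qed.
Next Obligation.
by move=> X Y f g /=; rewrite !vf_leibniz !vfD !vf_leibniz; ring.
Qed.

End VectorFields.

Section Algebroids.
Variables (R : realType) (M : manifold R).
Notation C := (cinf M).

(* The brackets and differentials below only depend on these data; the        *)
(* axioms are in is_lie_algebroid.  V is the module of sections.              *)
Record algebroid (V : lmodType C) := Algebroid {
  lbr : V -> V -> V;
  anchor : {linear V -> vfield M} }.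

(* Bilinearity over R follows from additivity and the Leibniz rule applied to *)
(* constant functions.                                                        *)
Record is_lie_algebroid (V : lmodType C) (L : algebroid V) : Prop := {
  lbrDr : forall X Y Z, lbr L X (Y + Z) = lbr L X Y + lbr L X Z;
  lbrC : forall X Y, lbr L X Y = - lbr L Y X;
  lbr_jacobi : forall X Y Z,
    lbr L X (lbr L Y Z) + lbr L Y (lbr L Z X) + lbr L Z (lbr L X Y) = 0;
  lbr_leibniz : forall X f Y,
    lbr L X (f *: Y) = f *: lbr L X Y + anchor L X f *: Y;
  anchor_lbr : forall X Y,
    anchor L (lbr L X Y) = vf_bracket (anchor L X) (anchor L Y) }.

Definition tangent : algebroid (vfield M) := Algebroid (@vf_bracket _ M) idfun.

Lemma tangent_is_lie_algebroid : is_lie_algebroid tangent.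
Proof.
split => [X Y Z|X Y|X Y Z|X f Y|X Y] //=; apply: vfield_ext => g /=.
- by rewrite vfD; ring.
- by ring.
- by rewrite !vfD !vfN; ring.
- by rewrite vf_leibniz; ring.
Qed.

Definition dual (V : lmodType C) := {linear V -> C^o}.

Definition pull (V W : lmodType C) (f : {linear V -> W}) (a : dual W) : dual V :=
  a \o f.

(* A p-vector is represented by the alternating p-linear form it induces on   *)
(* the dual, as a function on lists of covectors that vanishes on lists of    *)
(* length other than p.                                                       *)
Definition mv (V : lmodType C) := seq (dual V) -> C.

Definition mv_fun (V : lmodType C) (f : C) : mv V :=
  fun l => if l is [::] then f else 0.

Definition mv_vec (V : lmodType C) (X : V) : mv V :=
  fun l => if l is [:: a] then a X else 0.

Definition mv_contract (V : lmodType C) (a : dual V) (P : mv V) : mv V :=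
  fun l => P (a :: l).

(* i_a (P /\ Q) = i_a P /\ Q + (-1)^p P /\ i_a Q, so that                     *)
(* (X /\ Y)(a, b) = a(X) b(Y) - b(X) a(Y).                                    *)
Fixpoint mv_wedge (V : lmodType C) (P Q : mv V) (l : seq (dual V)) : C :=
  match l with
  | [::] => P [::] * Q [::]
  | a :: l' => mv_wedge (mv_contract a P) Q l' +
      mv_wedge (fun u => (-1) ^+ size u * P u) (mv_contract a Q) l'
  end.

(* Sections of the p-th exterior power: finite sums of f X_1 /\ ... /\ X_p.   *)
Definition multivector (V : lmodType C) (p : nat) (P : mv V) :=
  exists s : seq (C * p.-tuple V),
    P = \sum_(t <- s) mv_wedge (mv_fun t.1)
          (foldr (@mv_wedge V) (mv_fun 1) [seq mv_vec X | X <- t.2]).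

Definition push (V W : lmodType C) (f : {linear V -> W}) (P : mv V) : mv W :=
  fun l => P [seq pull f a | a <- l].

(* S is the Schouten bracket of L; these rules determine S P Q for all        *)
(* multivectors P and Q.  Exponents p - 1 are written p + 1.                  *)
Record is_schouten (V : lmodType C) (L : algebroid V)
    (S : mv V -> mv V -> mv V) : Prop := {
  sch_degree : forall p q P Q, multivector p P -> multivector q Q ->
    multivector (p + q).-1 (S P Q);
  sch_add : forall p q P Q Q',
    multivector p P -> multivector q Q -> multivector q Q' ->
    S P (Q + Q') = S P Q + S P Q';
  sch_fun : forall f g, S (mv_fun f) (mv_fun g) = 0;
  sch_vec_fun : forall X f, S (mv_vec X) (mv_fun f) = mv_fun (anchor L X f);
  sch_vec : forall X Y, S (mv_vec X) (mv_vec Y) = mv_vec (lbr L X Y);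
  sch_skew : forall p q P Q, multivector p P -> multivector q Q ->
    S P Q = - ((-1) ^+ (p.+1 * q.+1) *: S Q P);
  sch_leibniz : forall p q r P Q T,
    multivector p P -> multivector q Q -> multivector r T ->
    S P (mv_wedge Q T) =
      mv_wedge (S P Q) T + (-1) ^+ (p.+1 * q) *: mv_wedge Q (S P T) }.

(* The Schouten-Jacobi bracket of a p-vector P and a q-vector Q.              *)
Definition schouten_jacobi (V : lmodType C) (S : mv V -> mv V -> mv V)
    (phi : dual V) (p q : nat) (P Q : mv V) : mv V :=
  S P Q + (p%:R - 1) *: mv_wedge P (mv_contract phi Q)
  - ((-1) ^+ p.+1 * (q%:R - 1)) *: mv_wedge (mv_contract phi P) Q.

Definition cocycle (V : lmodType C) (L : algebroid V) (phi : dual V) :=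
  forall X Y, anchor L X (phi Y) - anchor L Y (phi X) - phi (lbr L X Y) = 0.

Definition is_sharp (V : lmodType C) (P : mv V) (Ps : dual V -> V) :=
  forall a b : dual V, b (Ps a) = P [:: a; b].

(* The bivector with sharp map Ps (a bivector when Ps is skew).               *)
Definition mv_of_sharp (V : lmodType C) (Ps : dual V -> V) : mv V :=
  fun l => if l is [:: a; b] then b (Ps a) else 0.

(* d^phi on functions and on 1-forms.                                         *)
Definition dphi0 (V : lmodType C) (L : algebroid V) (phi : dual V) (f : C)
    (X : V) : C :=
  anchor L X f + f * phi X.

Definition dphi1 (V : lmodType C) (L : algebroid V) (phi w : dual V)
    (X Y : V) : C :=
  anchor L X (w Y) - anchor L Y (w X) - w (lbr L X Y)
  + (phi X * w Y - phi Y * w X).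

Definition lie_phi (V : lmodType C) (L : algebroid V) (phi : dual V) (X : V)
    (b : dual V) (Z : V) : C :=
  dphi1 L phi b X Z + dphi0 L phi (b X) Z.

Definition dual_bracket (V : lmodType C) (L : algebroid V) (phi : dual V)
    (Q : mv V) (Qs : dual V -> V) (a b : dual V) (Z : V) : C :=
  lie_phi L phi (Qs a) b Z - lie_phi L phi (Qs b) a Z
  - dphi0 L phi (Q [:: a; b]) Z.

Definition bracketN (V : lmodType C) (L : algebroid V) (N : {linear V -> V})
    (X Y : V) : V :=
  lbr L (N X) Y + lbr L X (N Y) - N (lbr L X Y).

Definition deformed (V : lmodType C) (L : algebroid V) (N : {linear V -> V}) :
  algebroid V := Algebroid (bracketN L N) (anchor L \o N).

Definition nijenhuis (V : lmodType C) (L : algebroid V) (N : {linear V -> V}) :=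
  forall X Y, lbr L (N X) (N Y) = N (bracketN L N X Y).

(* S is the Schouten bracket of L, and Ps the sharp map of P.                 *)
Record jacobi_nijenhuis (V : lmodType C) (L : algebroid V)
    (S : mv V -> mv V -> mv V) (phi : dual V) (P : mv V) (Ps : dual V -> V)
    (N : {linear V -> V}) : Prop := {
  jn_lie : is_lie_algebroid L;
  jn_cocycle : cocycle L phi;
  jn_bivector : multivector 2 P;
  jn_jacobi : schouten_jacobi S phi 2 2 P P = 0;
  jn_nijenhuis : nijenhuis L N;
  jn_sharp : forall a, N (Ps a) = Ps (pull N a);
  jn_bracket : forall a b Z,
    dual_bracket L phi (mv_of_sharp (N \o Ps)) (N \o Ps) a b Z =
    dual_bracket (deformed L N) (pull N phi) P Ps a b Z }.

(* S is the Schouten bracket of multivector fields on M.                      *)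
Definition jacobi_structure (S : mv (vfield M) -> mv (vfield M) -> mv (vfield M))
    (Lam : mv (vfield M)) (E : vfield M) :=
  [/\ multivector 2 Lam,
      S Lam Lam = - (mv_wedge (mv_vec E) Lam *+ 2) &
      S (mv_vec E) Lam = 0].

Definition jacobi_compatible
    (S : mv (vfield M) -> mv (vfield M) -> mv (vfield M))
    (Lam1 : mv (vfield M)) (E1 : vfield M)
    (Lam2 : mv (vfield M)) (E2 : vfield M) :=
  jacobi_structure S (Lam1 + Lam2) (E1 + E2).

End Algebroids.

(* Main.v *)
From HB Require Import structures.
Require Import Defs.
From mathcomp Require Import all_boot all_order all_algebra.
From mathcomp Require Import all_classical all_reals all_analysis.
From mathcomp Require Import ring.
Set Implicit Arguments.
Unset Strict Implicit.
Unset Printing Implicit Defensive.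
Import Order.TTheory GRing.Theory Num.Theory.
Local Open Scope ring_scope.

(* On three covectors, [P, P] is twice the cyclic sum K of                    *)
(*   a[P#b, P#c] - (P#a).P(b, c),                                             *)
(* and replacing the anchor by the flat representation X.f + phi0(X) f turns  *)
(* this into [P, P]^phi0.  In the same terms, the bracket condition (2) says  *)
(*   b([P#a, NZ] - N[P#a, Z]) - a([P#b, NZ] - N[P#b, Z])                      *)
(*     = Z.P(a, N*b) - (NZ).P(a, b).                                          *)
(* This condition passes from (P, N) to (P, N^k) and to (NP, N).  Comparing   *)
(* its cyclic sum at Z = P#c with K(P, P) at (N*a, b, c), (a, N*b, c) and     *)
(* (a, b, N*c) gives K(P, NP) = 0; with the same argument for N^2 and the     *)
(* torsion of N one gets K(NP, NP) = 0, hence by induction all mixed brackets *)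
(* [N^i P, N^j P]^phi0 vanish.  Pushing forward along the anchor gives the    *)
(* first Jacobi identity on M; the second, [E, Lambda] = 0, is the first one  *)
(* evaluated at (phi0, a, b), because phi0 is closed.                         *)

(** The vanishing of the Magri-Morosi concomitant ([concomitant_free]) lets N move between the slots
    of K, and the vanishing torsion of N extends this to all powers. [concomitant_free_comp] and
    [concomitant_free_iter] propagate the condition, [koszul_concomitant] and [koszul_comp] deduce
    the vanishing of K, and [koszul_hierarchy] collects all mixed terms. These are scalar
    identities: each is a linear combination of hypotheses, which [lincomb] hands to [ring].

    [schouten_bivec] and [jacobi_koszul] connect K with the actual brackets. The descent to M is
    [jacobi_push], which accepts any bivector whose twisted K vanishes. Applied to N^i P it gives
    the Jacobi structures; applied to N^i P + N^j P, whose K vanishes because the mixed terms do, it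
    gives compatibility. *)

Lemma lincomb (C : zmodType) (x y z : C) : x = y -> z = x - y -> z = 0.
Proof. by move=> -> ->; rewrite subrr. Qed.

(** * Powers of N, for an abstract bracket, pairing and action *)

Section Hierarchy.
Variables (C : comPzRingType) (V : zmodType) (D : Type) (ev : D -> V -> C).
Variables (br : V -> V -> V) (act : V -> C -> C).
Hypothesis C_torsion_free : forall (f : C) n, f *+ n.+1 = 0 -> f = 0.
Hypothesis evB : forall a X Y, ev a (X - Y) = ev a X - ev a Y.
Hypothesis ev_brC : forall a X Y, ev a (br X Y) = - ev a (br Y X).
Implicit Types (Q : D -> V) (a b c : D) (X Y Z : V).

(** By the sharp convention [ev c (Q2 b)] is Q2(b, c). The action is a parameter because K is needed
    both for the anchor ([acts]) and for the flat representation ([twist]). *)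
Definition koszul_term Q1 Q2 a b c : C :=
  ev a (br (Q1 b) (Q2 c)) - act (Q1 a) (ev c (Q2 b)).

Definition koszul Q1 Q2 a b c : C :=
  koszul_term Q1 Q2 a b c + koszul_term Q1 Q2 b c a + koszul_term Q1 Q2 c a b.

Definition concomitant_free Q (J : V -> V) := forall a b Z,
  ev b (br (Q a) (J Z) - J (br (Q a) Z)) -
    ev a (br (Q b) (J Z) - J (br (Q b) Z)) =
  act Z (ev b (J (Q a))) - act (J Z) (ev b (Q a)).

Section Operator.
Variables (J : V -> V) (Jt : D -> D) (Q : D -> V).
Hypothesis JtE : forall a X, ev (Jt a) X = ev a (J X).
Hypothesis QJ : forall a, J (Q a) = Q (Jt a).
Hypothesis Q_free : concomitant_free Q J.
Hypothesis QQ : forall a b c, koszul Q Q a b c = 0.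

(** The sum of K(Q, Q) over the three places of [Jt] and the cyclic sum of the concomitant at Z = Qc
    are two linear relations between the same terms. Eliminating either way yields three times each
    conclusion. The second conclusion serves [koszul_comp], with J = N^2. *)
Lemma koszul_concomitant a b c :
  koszul Q (J \o Q) a b c + koszul (J \o Q) Q a b c = 0 /\
  (ev a (J (br (Q b) (Q c))) - act (Q a) (ev c (J (Q b)))) +
  (ev b (J (br (Q c) (Q a))) - act (Q b) (ev a (J (Q c)))) +
  (ev c (J (br (Q a) (Q b))) - act (Q c) (ev b (J (Q a)))) = 0.
Proof.
have Ta := QQ (Jt a) b c; have Tb := QQ a (Jt b) c; have Tc := QQ a b (Jt c).
have Da := Q_free a b (Q c); have Db := Q_free b c (Q a).
have Dc := Q_free c a (Q b).
move: Ta Tb Tc Da Db Dc; rewrite /koszul /koszul_term -!QJ /= !evB -!JtE.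
rewrite !(ev_brC _ (J (Q _)) (Q _)).
rewrite !(ev_brC _ (Q b) (Q a)) !(ev_brC _ (Q c) (Q b)) !(ev_brC _ (Q a) (Q c)).
rewrite !JtE => Ta Tb Tc Da Db Dc.
have T := congr2 +%R (congr2 +%R Ta Tb) Tc.
have D3 := congr2 +%R (congr2 +%R Da Db) Dc.
split; apply: (C_torsion_free (n := 2)).
  by apply: lincomb (congr2 (fun x y => x *+ 2 - y) T D3) _; ring.
by apply: lincomb (congr2 +%R T D3) _; ring.
Qed.
End Operator.

Section Nijenhuis.
Variables (N : V -> V) (Nt : D -> D).
Hypothesis NB : forall X Y, N (X - Y) = N X - N Y.
Hypothesis NtE : forall a X, ev (Nt a) X = ev a (N X).
Hypothesis N_torsion : forall X Y,
  br (N X) (N Y) = N (br (N X) Y + br X (N Y) - N (br X Y)).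

Lemma iter_adjoint k a X : ev (iter k Nt a) X = ev a (iter k N X).
Proof. by elim: k X => //= k IH X; rewrite NtE IH -iterS iterSr. Qed.

(** With (L_X N) Y = [X, NY] - N[X, Y], zero torsion reads L_{NX} N = N L_X N, which iterates to
    L_{N^k X} N = N^k L_X N. *)
Lemma iter_torsion k X Y :
  br (iter k N X) (N Y) - N (br (iter k N X) Y) =
  iter k N (br X (N Y) - N (br X Y)).
Proof.
elim: k => //= k <-; rewrite N_torsion -NB; congr (N _).
by rewrite addrC -addrA addKr.
Qed.

Section Bivector.
Variable Q : D -> V.
Hypothesis QN : forall a, N (Q a) = Q (Nt a).
Hypothesis Q_free : concomitant_free Q N.

Lemma iter_intertwines k a : iter k N (Q a) = Q (iter k Nt a).
Proof. by elim: k => //= k ->. Qed.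

(** This is the condition for Q at (a, Nt b): zero torsion pulls N out of the term paired with b,
    while in the term paired with a the section Q (Nt b) is already N (Q b). *)
Lemma concomitant_free_comp : concomitant_free (N \o Q) N.
Proof.
move=> a b Z /=; have := Q_free a (Nt b) Z.
by rewrite -QN !NtE !(iter_torsion 1) => <-.
Qed.

(** The step telescopes: the condition for N^k at (a, b, NZ) plus the one for N at (a, iter k Nt b,
    Z). The term paired with a in the latter is matched by [iter_torsion]. *)
Lemma concomitant_free_iter k : concomitant_free Q (iter k N).
Proof.
elim: k => [|k IH] a b Z /=; first by rewrite !evB !subrr.
have Jr X : iter k N (N X) = N (iter k N X) by rewrite -iterSr.
have D1 := IH a b (N Z); have := Q_free a (iter k Nt b) Z.
have := congr1 (ev a) (iter_torsion k (Q b) Z).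
rewrite -iter_intertwines !iter_adjoint.
have JB X Y : iter k N (X - Y) = iter k N X - iter k N Y.
  by elim: (k) => //= l ->.
move: D1; rewrite !JB !evB !Jr => D1 T D2.
apply/eqP; rewrite -subr_eq0; apply/eqP.
by apply: lincomb (congr2 +%R (congr2 +%R D1 D2) T) _; ring.
Qed.

Hypothesis QQ : forall a b c, koszul Q Q a b c = 0.

(** Sum K(Q, Q) over the three ways of putting [Nt] on two of the covectors. The relation for N^2
    removes the derivatives along Q, zero torsion rewrites the brackets containing a single N, and
    twice the claim remains. *)
Lemma koszul_comp a b c : koszul (N \o Q) (N \o Q) a b c = 0.
Proof.
have [_ X] := koszul_concomitant (iter_adjoint 2) (iter_intertwines 2)
  (concomitant_free_iter 2) QQ a b c.
have := QQ (Nt a) (Nt b) c; have := QQ a (Nt b) (Nt c).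
have := QQ (Nt a) b (Nt c).
move: X; rewrite /koszul /koszul_term -!QN /= !NtE => X Tb Tc Ta.
have N2 d Y Z : ev d (br (N Y) (N Z)) =
    ev d (N (br (N Y) Z)) - (ev d (N (N (br Y Z))) - ev d (N (br Y (N Z)))).
  by rewrite N_torsion -addrA -opprB !NB !evB.
have H := congr2 +%R (congr2 +%R (N2 a (Q b) (Q c)) (N2 b (Q c) (Q a)))
  (N2 c (Q a) (Q b)).
have T := congr2 +%R (congr2 +%R Ta Tb) Tc.
apply: (C_torsion_free (n := 1)).
by apply: lincomb (congr2 +%R (congr2 (fun x y => x - y) T X) H) _; ring.
Qed.

End Bivector.

Section Powers.
Variable Q : D -> V.
Hypothesis QN : forall a, N (Q a) = Q (Nt a).
Hypothesis Q_free : concomitant_free Q N.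
Hypothesis QQ : forall a b c, koszul Q Q a b c = 0.
Notation Qk k := (fun a => iter k N (Q a)).

Lemma iter_hierarchy k : [/\ forall a, N (Qk k a) = Qk k (Nt a),
  concomitant_free (Qk k) N & forall a b c, koszul (Qk k) (Qk k) a b c = 0].
Proof.
elim: k => [//|k [kN kfree kk]]; split=> [a||a b c].
- by rewrite iterS kN.
- exact: concomitant_free_comp.
- exact: koszul_comp.
Qed.

(** For i <= j, N^j Q is J applied to N^i Q with J = N^(j - i), so [koszul_concomitant] applies with
    base bivector N^i Q. *)
Lemma koszul_hierarchy i j a b c :
  koszul (Qk i) (Qk j) a b c + koszul (Qk j) (Qk i) a b c = 0.
Proof.
wlog ij : i j / (i <= j)%N.
  by move=> H; case: (leqP i j) => [/H //|/ltnW /H <-]; rewrite addrC.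
have [iN ifree ii] := iter_hierarchy i.
have [<- _] := koszul_concomitant (iter_adjoint (j - i))
  (iter_intertwines iN (j - i)) (concomitant_free_iter iN ifree (j - i))
  ii a b c.
suff -> : Qk j = (iter (j - i) N) \o (Qk i) by [].
by apply/funext => d /=; rewrite -iterD subnK.
Qed.

End Powers.
End Nijenhuis.
End Hierarchy.

(** * Wedge products and homogeneity *)

Section Multivectors.
Variables (R : realType) (M : manifold R) (V : lmodType (cinf M)).
Notation C := (cinf M).
Implicit Types (n m p : nat) (P Q : mv V) (X Y : V) (a b c : dual V).

(* Covectors take values in C^o; ev moves them to C, so that rewriting and    *)
(* ring see a single ring structure.                                          *)
Definition ev a X : C := a X.

Lemma evB a X Y : ev a (X - Y) = ev a X - ev a Y.
Proof. exact: raddfB. Qed.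

Lemma evD a X Y : ev a (X + Y) = ev a X + ev a Y.
Proof. exact: raddfD. Qed.

Lemma evN a X : ev a (- X) = - ev a X.
Proof. exact: raddfN. Qed.

Lemma ev0 a : ev a 0 = 0.
Proof. exact: raddf0. Qed.

Lemma evZ a f X : ev a (f *: X) = f * ev a X.
Proof. by rewrite /ev linearZ. Qed.

Lemma mv_wedge0l P l : mv_wedge (fun=> 0 : C) P l = 0.
Proof.
elim: l P => [|a l IH] P /=; first exact: mul0r.
rewrite IH (_ : (fun _ => _) = fun=> 0) ?IH ?addr0 //.
by apply/funext => u; rewrite mulr0.
Qed.

Lemma mv_wedge0r P l : mv_wedge P (fun=> 0 : C) l = 0.
Proof. by elim: l P => [|a l IH] P /=; rewrite ?mulr0 // !IH addr0. Qed.

Lemma mv_wedge_funl f P : mv_wedge (mv_fun f) P = (fun l => f * P l).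
Proof.
apply/funext => l; elim: l P => [|a l IH] P //=; rewrite mv_wedge0l add0r.
rewrite (_ : (fun _ => _) = mv_fun f); first by rewrite IH.
by apply/funext => -[|b u] /=; rewrite ?mul1r ?mulr0.
Qed.

Lemma mv_wedge_1r P : mv_wedge P (mv_fun 1) = P.
Proof.
apply/funext => l; elim: l P => [|a l IH] P /=; first exact: mulr1.
by rewrite IH mv_wedge0r addr0.
Qed.

(** Multivectors are functions on lists of every length; homogeneity reduces their equality to lists
    of one length, through [homog_eq]. *)
Definition homog (n : nat) P := forall l, size l != n -> P l = 0.

Lemma homog_eq n P Q : homog n P -> homog n Q ->
  (forall l, size l = n -> P l = Q l) -> P = Q.
Proof.
move=> Pn Qn PQ; apply/funext => l; have [/PQ //|ln] := eqVneq (size l) n.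
by rewrite Pn // Qn.
Qed.

Lemma homog_fun f : homog 0 (mv_fun f : mv V).
Proof. by case. Qed.

Lemma homog_vec X : homog 1 (mv_vec X).
Proof. by case=> [|a []]. Qed.

Lemma homog_wedge n m P Q : homog n P -> homog m Q ->
  homog (n + m)%N (mv_wedge P Q : mv V).
Proof.
move=> Pn Qm l; elim: l n m P Q Pn Qm => [|a l IH] n m P Q Pn Qm /= ln.
  case: n m Pn Qm ln => [|n] [|m] Pn Qm //= _.
  - by rewrite (Qm [::]) ?mulr0.
  - by rewrite (Pn [::]) ?mul0r.
  - by rewrite (Pn [::]) ?mul0r.
have shift k j T : homog k T -> (size l).+1 != (k + j)%N ->
    exists2 k', homog k' (mv_contract a T) & size l != (k' + j)%N.
  case: k => [|k] Tk lk; last by exists k => // u uk; exact: Tk.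
  (* For k = 0 the contraction vanishes identically, hence is homogeneous of any degree; this degree
     exceeds [size l], which keeps the lengths different. *)
  exists (size l).+1 => [u _|]; first exact: Tk.
  by rewrite addSn neq_ltn ltnS leq_addr.
have [k Pk lk] := shift _ _ _ Pn ln.
have [|k2 Qk2 lk2] := shift _ n _ Qm _; first by rewrite addnC.
rewrite (IH _ _ _ _ Pk Qm lk) (IH n k2) ?addr0 //; last by rewrite addnC.
by move=> u /Pn ->; rewrite mulr0.
Qed.

Lemma mv_sumE (I : Type) (s : seq I) (F : I -> mv V) l :
  (\sum_(i <- s) F i) l = \sum_(i <- s) F i l.
Proof.
by elim: s => [|i s IH]; rewrite ?big_nil // !big_cons -IH.
Qed.

End Multivectors.

(** * Bivectors as sums of X /\ Y *)

Section Bivectors.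
Variables (R : realType) (M : manifold R) (V : lmodType (cinf M)).
Notation C := (cinf M).
Implicit Types (n m p : nat) (P Q : mv V) (X Y : V) (a b c : dual V)
  (s : seq (V * V)).

Definition vec2 X Y : mv V := mv_wedge (mv_vec X) (mv_vec Y).

Lemma homog_vec2 X Y : homog 2 (vec2 X Y).
Proof. exact: (homog_wedge (homog_vec X) (homog_vec Y)). Qed.

Lemma vec2E X Y a b : vec2 X Y [:: a; b] = ev a X * ev b Y - ev b X * ev a Y.
Proof. by rewrite /vec2 /= /mv_contract /= /ev; ring. Qed.

Lemma mv_wedge_fun_vec2 f X Y :
  mv_wedge (mv_fun f) (mv_wedge (mv_vec X) (mv_wedge (mv_vec Y) (mv_fun 1)))
  = vec2 (f *: X) Y.
Proof.
rewrite mv_wedge_1r mv_wedge_funl -/(vec2 X Y).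
apply: (@homog_eq _ _ _ 2); first by move=> l /homog_vec2 ->; rewrite mulr0.
  exact: homog_vec2.
by move=> [|a [|b []]] // _; rewrite !vec2E !evZ; ring.
Qed.

Definition bivec s : mv V := \sum_(t <- s) vec2 t.1 t.2.

Lemma multivector_bivec s : multivector 2 (bivec s).
Proof.
exists [seq (1, [tuple t.1; t.2]) | t <- s].
rewrite big_map; apply: eq_bigr => t _; by rewrite /= mv_wedge_fun_vec2 scale1r.
Qed.

(** The function coefficient is absorbed into the first vector of each term. *)
Lemma multivector2_bivec P : multivector 2 P -> exists s, P = bivec s.
Proof.
case=> s ->; exists [seq (t.1 *: tnth t.2 ord0, tnth t.2 (inord 1)) | t <- s].
rewrite /bivec big_map; apply: eq_bigr => -[f [[|X [|Y []]] //= Xs]] _.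
by rewrite mv_wedge_fun_vec2 !(tnth_nth 0) /= inordK.
Qed.

Lemma multivector_vec X : multivector 1 (mv_vec X).
Proof.
exists [:: (1, [tuple X])]; rewrite big_seq1 /= mv_wedge_1r mv_wedge_funl.
by apply/funext => l; rewrite mul1r.
Qed.

Lemma multivector_homog p P : multivector p P -> homog p P.
Proof.
case=> s -> l lp; rewrite mv_sumE big1 // => -[f t] _ /=.
apply: (homog_wedge (homog_fun f)) lp => /=.
case: t => t /= /eqP <-; elim: t => [|X t IH] /=; first exact: homog_fun.
exact: (homog_wedge (homog_vec X)).
Qed.

End Bivectors.

Section Wedge2.
Variables (R : realType) (M : manifold R) (V : lmodType (cinf M)).
Implicit Types (P Q : mv V) (X : V) (a b c : dual V).

Lemma mvD P Q l : (P + Q) l = P l + Q l. Proof. by []. Qed.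
Lemma mvN P l : (- P) l = - P l. Proof. by []. Qed.

Lemma homogD n P Q : homog n P -> homog n Q -> homog n (P + Q).
Proof. by move=> Pn Qn l ln; rewrite mvD Pn // Qn // addr0. Qed.

Lemma homogN n P : homog n P -> homog n (- P).
Proof. by move=> Pn l ln; rewrite mvN Pn // oppr0. Qed.

Lemma mv_wedge_vec2r P X a b c : homog 2 P ->
  mv_wedge P (mv_vec X) [:: a; b; c] =
  P [:: a; b] * ev c X - P [:: a; c] * ev b X + P [:: b; c] * ev a X.
Proof.
move=> P2; rewrite /= /mv_contract /= -/(ev a X) -/(ev b X) -/(ev c X).
by rewrite (P2 [:: a]) // (P2 [:: b]) // (P2 [:: c]) // (P2 [:: a; b; c]) //
  (P2 [::]) //; ring.
Qed.

Lemma mv_wedge_vec2l P X a b c : homog 2 P ->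
  mv_wedge (mv_vec X) P [:: a; b; c] =
  ev a X * P [:: b; c] - ev b X * P [:: a; c] + ev c X * P [:: a; b].
Proof.
move=> P2; rewrite /= /mv_contract /= -/(ev a X) -/(ev b X) -/(ev c X).
by rewrite (P2 [:: a]) // (P2 [:: b]) // (P2 [:: c]) // (P2 [:: a; b; c]) //;
  ring.
Qed.

End Wedge2.

(** * The Schouten bracket in terms of K *)

Section LieAlgebroid.
Variables (R : realType) (M : manifold R) (V : lmodType (cinf M)).
Variables (L : algebroid V).
Hypothesis hL : is_lie_algebroid L.
Notation C := (cinf M).
Implicit Types (P Q : mv V) (X Y Z : V) (a b c : dual V) (f g : C)
  (s : seq (V * V)).

Lemma anchor0 g : anchor L 0 g = 0.
Proof. by rewrite raddf0. Qed.

Lemma anchorD X Y g : anchor L (X + Y) g = anchor L X g + anchor L Y g.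
Proof. by rewrite raddfD. Qed.

Lemma anchorZ f X g : anchor L (f *: X) g = f * anchor L X g.
Proof. by rewrite linearZ. Qed.

Lemma anchorN X g : anchor L (- X) g = - anchor L X g.
Proof. by rewrite -scaleN1r anchorZ mulN1r. Qed.

Lemma lbrDl X Y Z : lbr L (X + Y) Z = lbr L X Z + lbr L Y Z.
Proof. by rewrite !(lbrC hL _ Z) (lbrDr hL) opprD. Qed.

Lemma lbr0r X : lbr L X 0 = 0.
Proof. by apply: (@addrI _ (lbr L X 0)); rewrite -(lbrDr hL) !addr0. Qed.

Lemma lbr0l X : lbr L 0 X = 0.
Proof. by rewrite (lbrC hL) lbr0r oppr0. Qed.

Lemma lbrNr X Y : lbr L X (- Y) = - lbr L X Y.
Proof. by apply: (@addrI _ (lbr L X Y)); rewrite -(lbrDr hL) !subrr lbr0r. Qed.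

Lemma lbrNl X Y : lbr L (- X) Y = - lbr L X Y.
Proof. by rewrite (lbrC hL) lbrNr opprK (lbrC hL). Qed.

Lemma ev_lbrC a X Y : ev a (lbr L X Y) = - ev a (lbr L Y X).
Proof. by rewrite (lbrC hL) evN. Qed.

Lemma ev_lbrZr a f X Y :
  ev a (lbr L X (f *: Y)) = f * ev a (lbr L X Y) + anchor L X f * ev a Y.
Proof. by rewrite (lbr_leibniz hL) evD !evZ. Qed.

Lemma ev_lbrZl a f X Y :
  ev a (lbr L (f *: X) Y) = f * ev a (lbr L X Y) - anchor L Y f * ev a X.
Proof. by rewrite ev_lbrC ev_lbrZr (ev_lbrC _ Y); ring. Qed.

Definition acts X f := anchor L X f.
Notation kos := (koszul (@ev _ _ _) (lbr L) acts).

Lemma koszulDl (Q Q1 Q2 : dual V -> V) a b c :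
  kos (fun d => Q1 d + Q2 d) Q a b c = kos Q1 Q a b c + kos Q2 Q a b c.
Proof. by rewrite /koszul /koszul_term /acts !lbrDl !evD !anchorD; ring. Qed.

Lemma koszulDr (Q Q1 Q2 : dual V -> V) a b c :
  kos Q (fun d => Q1 d + Q2 d) a b c = kos Q Q1 a b c + kos Q Q2 a b c.
Proof. by rewrite /koszul /koszul_term /acts !(lbrDr hL) !evD !vfD; ring. Qed.

Definition sharp2 X Y a : V := ev a X *: Y - ev a Y *: X.

Section Schouten.
Variable S : mv V -> mv V -> mv V.
Hypothesis hS : is_schouten L S.

Lemma multivector_vec2 X Y : multivector 2 (vec2 X Y).
Proof. by have := multivector_bivec [:: (X, Y)]; rewrite /bivec big_seq1. Qed.

Lemma schouten_vec_vec2 X Y Z :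
  S (mv_vec Z) (vec2 X Y) = vec2 (lbr L Z X) Y + vec2 X (lbr L Z Y).
Proof.
rewrite (sch_leibniz hS (multivector_vec _) (multivector_vec _)
  (multivector_vec _)).
by rewrite !(sch_vec hS) sqrrN expr1n scale1r.
Qed.

Lemma schouten_vec2_vec X Y Z :
  S (vec2 X Y) (mv_vec Z) = - (vec2 (lbr L Z X) Y + vec2 X (lbr L Z Y)).
Proof.
rewrite (sch_skew hS (multivector_vec2 _ _) (multivector_vec _)).
rewrite schouten_vec_vec2 (_ : (-1) ^+ _ = 1) ?scale1r //.
by rewrite -signr_odd.
Qed.

(** The Leibniz rule expands the left side into the four brackets of X, Y with Z, W. On the right
    the coefficients [ev a X] get differentiated, but these derivatives cancel between the bracket
    terms and the anchor terms. *)
Lemma schouten_vec2 X Y Z W a b c :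
  S (vec2 X Y) (vec2 Z W) [:: a; b; c] =
  kos (sharp2 X Y) (sharp2 Z W) a b c + kos (sharp2 Z W) (sharp2 X Y) a b c.
Proof.
rewrite (sch_leibniz hS (multivector_vec2 _ _) (multivector_vec _)
  (multivector_vec _)).
rewrite !schouten_vec2_vec (_ : (-1) ^+ _ = -1); last by rewrite -signr_odd.
rewrite /koszul /koszul_term /sharp2 /acts.
rewrite !(lbrDr hL, lbrDl, lbrNr, lbrNl, evD, evN).
rewrite !(ev_lbrZr, ev_lbrZl, evZ).
rewrite !(anchorD, anchorN, anchorZ).
rewrite !(vfD, vfN, vf_leibniz).
rewrite !(ev_lbrC _ Z) !(ev_lbrC _ W).
rewrite scaleN1r !(mvD, mvN).
rewrite mv_wedge_vec2r ?mv_wedge_vec2l;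
  do ?[by apply/homogN/homogD; exact: homog_vec2].
rewrite !(mvD, mvN, vec2E) !(ev_lbrC _ Z) !(ev_lbrC _ W).
ring.
Qed.

Definition bivec_sharp s a : V := \sum_(t <- s) sharp2 t.1 t.2 a.

Lemma bivec_sharp_cons t s :
  bivec_sharp (t :: s) = fun a => sharp2 t.1 t.2 a + bivec_sharp s a.
Proof. by apply/funext => a; rewrite /bivec_sharp big_cons. Qed.

Lemma bivec_sharp_nil : bivec_sharp [::] = fun=> 0.
Proof. by apply/funext => a; rewrite /bivec_sharp big_nil. Qed.

Lemma bivec_cons t s : bivec (t :: s) = vec2 t.1 t.2 + bivec s.
Proof. by rewrite /bivec big_cons. Qed.

Lemma bivec_nil : bivec [::] = 0 :> mv V.
Proof. by rewrite /bivec big_nil. Qed.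

Lemma bivecE s a b : bivec s [:: a; b] = ev b (bivec_sharp s a).
Proof.
elim: s => [|t s IH]; first by rewrite bivec_nil bivec_sharp_nil ev0.
rewrite bivec_cons bivec_sharp_cons mvD IH evD vec2E /sharp2 evB !evZ.
by congr (_ + _); ring.
Qed.

Lemma koszul0l (Q : dual V -> V) a b c : kos (fun=> 0) Q a b c = 0.
Proof.
by rewrite /koszul /koszul_term /acts !lbr0l !ev0 !anchor0 ?vf0 !subrr !addr0.
Qed.

Lemma koszul0r (Q : dual V -> V) a b c : kos Q (fun=> 0) a b c = 0.
Proof.
by rewrite /koszul /koszul_term /acts !lbr0r !ev0 !vf0 !subrr !addr0.
Qed.

Lemma schouten0r p P : multivector p P -> S P 0 = 0.
Proof.
move=> hP; have h0 : multivector 2 (0 : mv V).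
  by rewrite -bivec_nil; exact: multivector_bivec.
by apply: (@addrI _ (S P 0)); rewrite -(sch_add hS hP h0 h0) !addr0.
Qed.

Lemma schouten_bivecr t s' a b c (tX := sharp2 t.1 t.2) (sX := bivec_sharp s') :
  S (vec2 t.1 t.2) (bivec s') [:: a; b; c] = kos tX sX a b c + kos sX tX a b c.
Proof.
have m2 := multivector_vec2; rewrite {}/sX.
elim: s' => [|u s' IH].
  rewrite bivec_nil bivec_sharp_nil (schouten0r (m2 _ _)).
  by rewrite koszul0l koszul0r addr0.
rewrite bivec_cons bivec_sharp_cons.
rewrite (sch_add hS (m2 _ _) (m2 _ _) (multivector_bivec _)) mvD IH.
rewrite schouten_vec2.
by rewrite koszulDl koszulDr /tX; ring.
Qed.

(** The rules for S give additivity in the second argument; since S is symmetric on bivectors (sign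
    -(-1)^9), swapping the arguments gives it in the first. *)
Lemma schouten_bivec s s' a b c (sX := bivec_sharp s) (sX' := bivec_sharp s') :
  S (bivec s) (bivec s') [:: a; b; c] = kos sX sX' a b c + kos sX' sX a b c.
Proof.
have m2 := multivector_vec2; have mb := @multivector_bivec _ _ V.
have SC P Q : multivector 2 P -> multivector 2 Q -> S P Q = S Q P.
  move=> hP hQ; rewrite (sch_skew hS hP hQ) (_ : (-1) ^+ _ = -1).
    by rewrite scaleN1r opprK.
  by rewrite -signr_odd.
rewrite {}/sX; elim: s => [|t s IH].
  rewrite bivec_nil bivec_sharp_nil SC ?(schouten0r (mb _)) //.
    by rewrite koszul0l koszul0r addr0.
  by rewrite -bivec_nil.
have mts : multivector 2 (vec2 t.1 t.2 + bivec s) by rewrite -bivec_cons.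
rewrite bivec_cons bivec_sharp_cons SC //.
rewrite (sch_add hS (mb _) (m2 _ _) (mb _)) mvD !(SC (bivec s')) //.
by rewrite IH schouten_bivecr koszulDl koszulDr; ring.
Qed.

Lemma schouten_vec_bivec Z s a b (sX := bivec_sharp s) :
  S (mv_vec Z) (bivec s) [:: a; b] =
  ev b (lbr L Z (sX a)) - ev a (lbr L Z (sX b)) - anchor L Z (ev b (sX a)).
Proof.
rewrite {}/sX; have m1 := multivector_vec Z; elim: s => [|t s IH].
  rewrite bivec_nil bivec_sharp_nil (schouten0r m1).
  by rewrite !lbr0r !ev0 vf0 !subrr.
rewrite bivec_cons bivec_sharp_cons.
rewrite (sch_add hS m1 (multivector_vec2 _ _) (multivector_bivec _)) mvD IH.
rewrite schouten_vec_vec2 mvD !vec2E !(lbrDr hL) !evD vfD /sharp2.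
rewrite !(lbrDr hL, lbrNr, evD, evN) !(ev_lbrZr, evZ).
by rewrite !(vfD, vfN, vf_leibniz); ring.
Qed.

(** The covector is df. It detects the anchor of a section by pairing alone. *)
Lemma dual_anchor f : exists w : dual V, forall X, ev w X = anchor L X f.
Proof.
have lin : linear_for *:%R ((fun X => anchor L X f) : V -> C^o).
  by move=> g X Y; rewrite anchorD anchorZ.
pose w : dual V := HB.pack ((fun X => anchor L X f) : V -> C^o)
  (GRing.isLinear.Build _ _ _ _ _ lin).
by exists w.
Qed.

(** The covector is the Lie derivative of b along Z; the two derivatives of a coefficient cancel,
    which makes it linear over functions. *)
Lemma dual_lie Z b : exists w : dual V,
  forall X, ev w X = anchor L Z (ev b X) - ev b (lbr L Z X).
Proof.
pose F : V -> C^o := fun X => anchor L Z (ev b X) - ev b (lbr L Z X).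
have lin : linear_for *:%R F.
  move=> g X Y; rewrite /F (lbrDr hL) !evD ev_lbrZr evZ vfD vf_leibniz.
  rewrite /GRing.scale /=; ring.
pose w : dual V := HB.pack F (GRing.isLinear.Build _ _ _ _ _ lin).
by exists w.
Qed.

End Schouten.
End LieAlgebroid.

Lemma cinf_mulrIn (R : realType) (M : manifold R) (f : cinf M) (n : nat) :
  f *+ n.+1 = 0 -> f = 0.
Proof. by move=> /eqP; rewrite -scaler_nat scaler_eq0 pnatr_eq0 => /eqP. Qed.

(** * Sharp maps known only through pairings *)

Section Sharp.
Variables (R : realType) (M : manifold R) (V : lmodType (cinf M)).
Variables (L : algebroid V).
Hypothesis hL : is_lie_algebroid L.
Notation C := (cinf M).
Implicit Types (P Q : mv V) (X Y Z : V) (a b c : dual V) (f g : C).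

(* A sharp map is only determined up to sections killed by all covectors;     *)
(* these have zero anchor and form an ideal for the bracket.                  *)
Definition ev_eq X Y := forall a, ev a X = ev a Y.

Lemma ev_eq_anchor X Y f : ev_eq X Y -> anchor L X f = anchor L Y f.
Proof. by move=> XY; have [w wE] := dual_anchor L f; rewrite -!wE. Qed.

Lemma ev_eq_lbrr Z X Y : ev_eq X Y -> ev_eq (lbr L Z X) (lbr L Z Y).
Proof.
move=> XY b; have [w wE] := dual_lie hL Z b.
by have := XY w; rewrite !wE XY => /addrI /oppr_inj.
Qed.

Lemma ev_eq_lbr X X' Y Y' a : ev_eq X X' -> ev_eq Y Y' ->
  ev a (lbr L X Y) = ev a (lbr L X' Y').
Proof.
move=> XX' YY'; rewrite (ev_eq_lbrr X YY') !(ev_lbrC hL _ _ Y').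
by rewrite (ev_eq_lbrr Y' XX').
Qed.

Variable S : mv V -> mv V -> mv V.
Hypothesis hS : is_schouten L S.
Variables (P : mv V) (Ps : dual V -> V).
Hypotheses (P2 : multivector 2 P) (PsE : is_sharp P Ps).

Lemma sharpE a b : P [:: a; b] = ev b (Ps a).
Proof. by rewrite -PsE. Qed.

Lemma sharp_bivec :
  exists2 s, P = bivec s & forall a, ev_eq (Ps a) (bivec_sharp s a).
Proof.
have [s Ps_s] := multivector2_bivec P2; exists s => // a b.
by rewrite -sharpE Ps_s bivecE.
Qed.

Lemma sharp_skew a b : ev a (Ps b) = - ev b (Ps a).
Proof.
have [s _ PsS] := sharp_bivec; rewrite !PsS /bivec_sharp.
elim: s {PsS} => [|t s IH]; first by rewrite !big_nil !ev0 oppr0.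
rewrite !big_cons !evD IH opprD; congr (_ - _).
by rewrite /sharp2 !(evD, evN, evZ); ring.
Qed.

Lemma schouten_sharp a b c :
  S P P [:: a; b; c] = koszul (@ev _ _ _) (lbr L) (acts L) Ps Ps a b c *+ 2.
Proof.
have [s -> PsS] := sharp_bivec; rewrite (schouten_bivec hL hS) -mulr2n.
congr (_ *+ 2); rewrite /koszul /koszul_term /acts.
rewrite -!(ev_eq_lbr _ (PsS _) (PsS _)) -!(ev_eq_anchor _ (PsS _)).
by rewrite !PsS.
Qed.

Lemma schouten_vec_sharp Z a b : S (mv_vec Z) P [:: a; b] =
  ev b (lbr L Z (Ps a)) - ev a (lbr L Z (Ps b)) - anchor L Z (ev b (Ps a)).
Proof.
have [s -> PsS] := sharp_bivec; rewrite (schouten_vec_bivec hL hS).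
by rewrite -!(ev_eq_lbrr Z (PsS _)) PsS.
Qed.

Lemma contract_sharp a : mv_contract a P = mv_vec (Ps a).
Proof.
apply: (@homog_eq _ _ _ 1); last 1 first.
- by case=> [|b []] // _; rewrite /mv_contract sharpE.
- by move=> l l1; apply: (multivector_homog P2).
- exact: homog_vec.
Qed.

End Sharp.

(** * The twist by phi0 *)

Section Twisted.
Variables (R : realType) (M : manifold R) (V : lmodType (cinf M)).
Variables (L : algebroid V) (phi : dual V).
Hypothesis hL : is_lie_algebroid L.
Notation C := (cinf M).
Implicit Types (Q : dual V -> V) (X Y Z : V) (a b c : dual V).

Definition twist X (f : C) : C := dphi0 L phi f X.

Notation kos := (koszul (@ev _ _ _) (lbr L) (acts L)).
Notation koszul_phi := (koszul (@ev _ _ _) (lbr L) twist).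

Lemma koszul_twist Q1 Q2 a b c : koszul_phi Q1 Q2 a b c = kos Q1 Q2 a b c -
  (ev c (Q2 b) * ev phi (Q1 a) + ev a (Q2 c) * ev phi (Q1 b) +
   ev b (Q2 a) * ev phi (Q1 c)).
Proof.
rewrite /koszul /koszul_term /twist /dphi0 /acts.
rewrite -/(ev phi (Q1 a)) -/(ev phi (Q1 b)) -/(ev phi (Q1 c)); ring.
Qed.

(** For p = q = 2 the correction terms are P /\ i_phi P + i_phi P /\ P, with i_phi P the vector
    [Ps phi]. On three covectors they are twice the phi terms of [koszul_twist], so the bracket is
    twice the twisted K. *)
Lemma jacobi_koszul S (P : mv V) (Ps : dual V -> V) a b c :
  is_schouten L S -> multivector 2 P -> is_sharp P Ps ->
  schouten_jacobi S phi 2 2 P P = 0 -> koszul_phi Ps Ps a b c = 0.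
Proof.
move=> hS P2 PsE /(congr1 (fun T => T [:: a; b; c])).
rewrite /schouten_jacobi (contract_sharp P2 PsE).
have -> : (2%:R - 1) = 1 :> R by rewrite (natrD _ 1 1) addrK.
rewrite mulr1 -signr_odd expr1 scale1r scaleN1r opprK.
rewrite !mvD (schouten_sharp hL hS P2 PsE).
rewrite (mv_wedge_vec2r _ _ _ _ (multivector_homog P2)).
rewrite (mv_wedge_vec2l _ _ _ _ (multivector_homog P2)).
rewrite !(sharpE PsE) !(sharp_skew P2 PsE _ phi) (sharp_skew P2 PsE c a).
move=> H; apply: (@cinf_mulrIn _ _ _ 1); rewrite -[RHS]H koszul_twist.
by ring.
Qed.

Lemma evE a X : a X = ev a X. Proof. by []. Qed.

(** Evaluated at Z, both brackets contain the twisted derivative of b(Z) along N (Ps a) and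
    b([N (Ps a), Z]), and likewise with a and b exchanged. After these cancel, the concomitant
    remains. *)
Lemma dual_bracket_concomitant (P : mv V) (Ps : dual V -> V)
    (N : {linear V -> V}) : is_sharp P Ps ->
  (forall a b Z, dual_bracket L phi (mv_of_sharp (N \o Ps)) (N \o Ps) a b Z =
    dual_bracket (deformed L N) (pull N phi) P Ps a b Z) ->
  concomitant_free (@ev _ _ _) (lbr L) twist Ps N.
Proof.
move=> PsE H a b Z; have := H a b Z.
rewrite /dual_bracket (sharpE PsE) /lie_phi /dphi1 /dphi0 /= /bracketN.
rewrite /twist /dphi0 !(evE a) !(evE b) !(evE phi) !evD !evN => {}H.
apply/eqP; rewrite -subr_eq0; apply/eqP.
by apply: lincomb H _; ring.
Qed.

End Twisted.

(** * The powers of N applied to P are bivectors *)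

Section Powers.
Variables (R : realType) (M : manifold R) (V : lmodType (cinf M)).
Notation C := (cinf M).
Implicit Types (P : mv V) (X Y Z : V) (a b c : dual V).

Lemma multivectorD p P Q : multivector p P -> multivector p Q ->
  multivector p (P + Q).
Proof. by move=> [s ->] [t ->]; exists (s ++ t); rewrite big_cat. Qed.

Lemma bivec_cat (s t : seq (V * V)) : bivec (s ++ t) = bivec s + bivec t.
Proof. exact: big_cat. Qed.

Lemma bivec_map (T : Type) (F G : T -> V) (s : seq T) :
  bivec [seq (F t, G t) | t <- s] = \sum_(t <- s) vec2 (F t) (G t).
Proof. exact: big_map. Qed.

Lemma multivectorZ p (f : C) P : multivector p P ->
  multivector p ((fun l => f * P l) : mv V).
Proof.
case=> s ->; exists [seq (f * t.1, t.2) | t <- s].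
apply/funext => l; rewrite big_map !mv_sumE mulr_sumr.
by apply: eq_bigr => t _; rewrite !mv_wedge_funl mulrA.
Qed.

Definition half : C := (2%:R^-1 : R) *: (1 : C).

Lemma halfK (f : C) : half * (f *+ 2) = f.
Proof.
rewrite /half -cinf_scaleA mul1r -(@scaler_nat R _ 2 f) scalerA.
by rewrite mulVf ?scale1r ?pnatr_eq0.
Qed.

(** [mv_of_sharp] only prescribes values, while a bivector must be a finite sum of decomposable
    ones. Moving J to the covectors through [Jt] produces the summands from a decomposition of P. *)
Lemma multivector_of_sharp (P : mv V) (Ps : dual V -> V) (J : V -> V)
    (Jt : dual V -> dual V) :
  multivector 2 P -> is_sharp P Ps -> (forall a X, ev (Jt a) X = ev a (J X)) ->
  (forall a, J (Ps a) = Ps (Jt a)) -> multivector 2 (mv_of_sharp (J \o Ps)).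
Proof.
move=> P2 PsE JtE JP; have [s _ PsS] := sharp_bivec P2 PsE.
(* By skew-symmetry, 2 (J P) is the sum of X /\ J Y + J X /\ Y. *)
pose s2 := [seq (t.1, J t.2) | t <- s] ++ [seq (J t.1, t.2) | t <- s].
have -> : mv_of_sharp (J \o Ps) = fun l => half * bivec s2 l.
  apply: (@homog_eq _ _ _ 2); first by move=> [|? [|? []]].
    by move=> l l2; rewrite (multivector_homog (multivector_bivec s2)) ?mulr0.
  move=> [|a [|b []]] // _; rewrite -[LHS]halfK; congr (_ * _).
  rewrite mulr2n -[mv_of_sharp _ _]/(ev b (J (Ps a))) {2}JP.
  rewrite (sharp_skew P2 PsE b) -!JtE !PsS.
  rewrite bivec_cat mvD !bivec_map !mv_sumE /bivec_sharp.
  elim: s {PsS s2} => [|t s IH]; first by rewrite !big_nil !ev0 subr0 addr0.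
  rewrite !big_cons !(evD _ (sharp2 _ _ _)) addrACA -IH !vec2E -!JtE.
  rewrite [ev _ (sharp2 _ _ a)]evB [ev _ (sharp2 _ _ b)]evB !evZ.
  ring.
by apply: multivectorZ; exact: multivector_bivec.
Qed.

End Powers.

(** * Push-forward along the anchor *)

Section PushForward.
Variables (R : realType) (M : manifold R) (V : lmodType (cinf M)).
Variables (L : algebroid V) (phi : dual V).
Hypotheses (hL : is_lie_algebroid L) (phi_closed : cocycle L phi).
Variable SM : mv (vfield M) -> mv (vfield M) -> mv (vfield M).
Hypothesis hSM : is_schouten (tangent M) SM.
Notation C := (cinf M).
Notation rho := (anchor L).

Lemma multivector_push (P : mv V) :
  multivector 2 P -> multivector 2 (push rho P).
Proof.
move=> /multivector2_bivec [s ->].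
have -> : push rho (bivec s) = bivec [seq (rho t.1, rho t.2) | t <- s].
  apply/funext => l; rewrite /push /bivec big_map !mv_sumE.
  apply: eq_bigr => t _; case: (eqVneq (size l) 2) => [|l2].
    by case: l => [|a [|b []]] // _; rewrite /= !vec2E.
  by rewrite !homog_vec2 ?size_map.
exact: multivector_bivec.
Qed.

(** The anchor preserves brackets, so K on M is K of Q on pulled-back covectors. The twisted K being
    zero, only phi terms remain, and by skewness of Q they are the values of -E /\ Lam. For
    [E, Lam], the triple starts with phi: the products of phi terms cancel, and the cocycle
    condition removes what is left besides [E, Lam]. *)
Lemma jacobi_push (Q : dual V -> V) : multivector 2 (mv_of_sharp Q) ->
  (forall a b c, koszul (@ev _ _ _) (lbr L) (twist L phi) Q Q a b c = 0) ->
  jacobi_structure SM (push rho (mv_of_sharp Q)) (rho (Q phi)).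
Proof.
move=> Q2 QQ; set Lam := push _ _; set E := rho _.
have Qsharp : is_sharp (mv_of_sharp Q) Q by [].
have Qskew := sharp_skew Q2 Qsharp.
pose LamS (a : dual (vfield M)) := rho (Q (pull rho a)).
have LamE : is_sharp Lam LamS by [].
have Lam2 : multivector 2 Lam by exact: multivector_push.
have hT := tangent_is_lie_algebroid M.
have E1 := multivector_vec E.
have brE x X Y : ev x (lbr (tangent M) (rho X) (rho Y)) =
    ev (pull rho x) (lbr L X Y).
  by rewrite /ev /= (anchor_lbr hL).
have LamQ x y : Lam [:: x; y] = ev (pull rho y) (Q (pull rho x)) by [].
have EQ x : ev x E = - ev phi (Q (pull rho x)) := Qskew (pull rho x) phi.
split=> //.
- apply: (@homog_eq _ _ _ 3).
  + exact: multivector_homog (sch_degree hSM Lam2 Lam2).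
  + have EL := homog_wedge (homog_vec E) (multivector_homog Lam2).
    by apply: homogN; rewrite mulr2n; apply: homogD.
  move=> [|a [|b [|c []]]] // _.
  rewrite (schouten_sharp hT hSM Lam2 LamE) mvN !mulr2n mvD.
  rewrite (mv_wedge_vec2l _ _ _ _ (multivector_homog Lam2)).
  have := QQ (pull rho a) (pull rho b) (pull rho c).
  rewrite koszul_twist /koszul /koszul_term /acts /LamS !brE.
  rewrite !LamQ !EQ (Qskew (pull rho c) (pull rho a)) => H.
  apply/eqP; rewrite -subr_eq0; apply/eqP.
  by apply: lincomb (congr1 (fun x => x *+ 2) H) _; ring.
- apply: (@homog_eq _ _ _ 2) => //.
    exact: multivector_homog (sch_degree hSM E1 Lam2).
  move=> [|a [|b []]] // _.
  rewrite (schouten_vec_sharp hT hSM Lam2 LamE) /LamS !brE -[RHS]/(0 : C).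
  rewrite -[anchor _ E _]/(rho (Q phi) (ev (pull rho b) (Q (pull rho a)))).
  have := phi_closed (Q (pull rho a)) (Q (pull rho b)).
  rewrite !(evE phi).
  have phi2 : ev phi (Q phi) = 0.
    apply: (@cinf_mulrIn _ _ _ 1).
    by rewrite mulr2n {1}Qskew addNr.
  have := QQ phi (pull rho a) (pull rho b).
  rewrite koszul_twist /koszul /koszul_term /acts phi2.
  rewrite !(Qskew (pull rho a) phi) !vfN (ev_lbrC hL _ (Q (pull rho b))).
  move=> H0 H1.
  apply/eqP; rewrite -subr_eq0; apply/eqP.
by apply: lincomb (congr2 +%R H0 H1) _; ring.
Qed.

End PushForward.

Theorem corollary7 (R : realType) (M : manifold R) (A : vbundle M)
    (L : algebroid (section A))
    (SA : mv (section A) -> mv (section A) -> mv (section A))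
    (SM : mv (vfield M) -> mv (vfield M) -> mv (vfield M))
    (phi0 : dual (section A)) (P : mv (section A))
    (Ps : dual (section A) -> section A) (N : {linear section A -> section A})
    (hSA : is_schouten L SA) (hSM : is_schouten (tangent M) SM)
    (hPs : is_sharp P Ps) (hJN : jacobi_nijenhuis L SA phi0 P Ps N) :
  let Lam k := push (anchor L) (mv_of_sharp (fun a => iter k N (Ps a))) in
  let E k := anchor L (iter k N (Ps phi0)) in
  (forall k, jacobi_structure SM (Lam k) (E k)) /\
  (forall i j, jacobi_compatible SM (Lam i) (E i) (Lam j) (E j)).
Proof.
case: hJN => hL phi_closed P2 PJ N0 NP PN Lam E.
have P_free := dual_bracket_concomitant hPs PN.
have PP a b c := jacobi_koszul hL a b c hSA P2 hPs PJ.
have NB X Y : N (X - Y) = N X - N Y by exact: raddfB.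
have tf (f : cinf M) n : f *+ n.+1 = 0 -> f = 0 by exact: cinf_mulrIn.
have NtE a X : ev (pull N a) X = ev a (N X) by [].
have H := koszul_hierarchy tf (@evB _ _ _) (ev_lbrC hL) NB NtE N0 NP P_free PP.
pose Q k a := iter k N (Ps a).
have Q2 k : multivector 2 (mv_of_sharp (Q k)).
  exact: multivector_of_sharp P2 hPs (iter_adjoint NtE k)
    (iter_intertwines NP k).
have QQ k a b c :
    koszul (@ev _ _ _) (lbr L) (twist L phi0) (Q k) (Q k) a b c = 0.
  (* The case i = j of [H] is twice the required identity. *)
  by apply: (@cinf_mulrIn _ _ _ 1); rewrite mulr2n H.
split=> [k|i j]; first exact: (jacobi_push hL phi_closed hSM (Q2 k) (QQ k)).
rewrite /jacobi_compatible.
(* Compatibility is [jacobi_push] for the single sharp map Q i + Q j. *)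
have -> : Lam i + Lam j =
    push (anchor L) (mv_of_sharp (fun a => Q i a + Q j a)).
  apply/funext => l; rewrite mvD /Lam /push /mv_of_sharp.
  case: l => [|a [|b [|c l]]] /=; rewrite ?addr0 //.
  exact: (esym (evD (pull (anchor L) b) _ _)).
have -> : E i + E j = anchor L (Q i phi0 + Q j phi0) by rewrite raddfD.
apply: (jacobi_push hL phi_closed hSM (Q := fun a => Q i a + Q j a)).
  have -> : mv_of_sharp (fun a => Q i a + Q j a) =
      mv_of_sharp (Q i) + mv_of_sharp (Q j).
    apply/funext => l; rewrite mvD.
    case: l => [|a [|b [|c l]]] /=; rewrite ?addr0 //; exact: evD.
  exact: multivectorD.
(* K is additive in each argument, so K of the sum is the two diagonal terms plus the mixed pair of
   [H]. *)
move=> a b c; have := H i j a b c; have := QQ i a b c; have := QQ j a b c.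
rewrite !koszul_twist (koszulDl hL) !(koszulDr hL) !evD => Hj Hi Hij.
by apply: lincomb (congr2 +%R (congr2 +%R Hi Hj) Hij) _; rewrite /Q; ring.
Qed.
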